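(* There exists an absolute constant $C>0$ such that for all positive integers $n\ge k\ge 3$ and all positive integers $r,s$ with $r>s>r/2$, $$A_k(n;r,s)\le T_{k-3}\!\left(n^{C\binom{r}{s}^2\log\binom{r}{s}}\right).$$
   Context: The tower function is defined by $T_0(m)=m$ and $T_{j+1}(m)=2^{T_j(m)}$. For a natural number $N$, $[N]=\{1,\dots,N\}$ and $[N]^{(k)}$ denotes the set of $k$-element subsets of $[N]$. A tight monotone path of length $n$ (on $n$ edges) in a $k$-uniform hypergraph on vertex set $[N]$ is determined by vertices $v_1<\dots<v_{n+k-1}$ in $[N]$ and consists of the $n$ edges $\{v_i,\dots,v_{i+k-1}\}$, $1\le i\le n$. For positive integers $n\ge k$ and $r>s$, $A_k(n;r,s)$ is the least $N$ such that every coloring of $[N]^{(k)}$ with $r$ colors contains a tight monotone path on $n$ edges whose edges use at most $s$ distinct colors. *)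

(* Defs.v *)
From mathcomp Require Import all_boot all_order all_algebra.
From mathcomp Require Import all_classical all_reals all_analysis.
Set Implicit Arguments.
Unset Strict Implicit.
Unset Printing Implicit Defensive.
Import Order.TTheory GRing.Theory Num.Theory.
Local Open Scope ring_scope.

(* The argument of the tower is real because the bound applies it to a real
   power of n. *)
Fixpoint tower (R : realType) (j : nat) (x : R) : R :=
  if j is j'.+1 then 2 `^ tower j' x else x.

(* 'I_N = {0, ..., N-1} stands for [N] = {1, ..., N}; only the order matters. *)
Definition monotone_vertices (N m : nat) (v : 'I_m -> 'I_N) : Prop :=
  {homo v : i j / (i < j)%N}.

(* Indices are shifted to start at 0: edge i is {v_i, ..., v_(i+k-1)}. *)
Definition path_edge (N k n : nat) (v : 'I_(n + k).-1 -> 'I_N) (i : 'I_n) :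
    {set 'I_N} :=
  [set v j | j : 'I_(n + k).-1 & (i <= j < i + k)%N].

(* A coloring is a function on all subsets of the vertex set, but only its
   values on k-element subsets are ever used: for k > 0 and v increasing, each
   path_edge has exactly k elements.  As r > 0 in all uses, every coloring of
   the k-element subsets extends to such a function. *)
Definition forces_path (k n r s N : nat) : Prop :=
  forall c : {set 'I_N} -> 'I_r,
    exists2 v : 'I_(n + k).-1 -> 'I_N,
      monotone_vertices v &
      (#|[set c (path_edge v i) | i : 'I_n]| <= s)%N.

(* is_A k n r s N states that A_k(n; r, s) exists and equals N. *)
Definition is_A (k n r s N : nat) : Prop :=
  forces_path k n r s N /\
  forall M : nat, forces_path k n r s M -> (N <= M)%N.

(* Main.v *)
Require Import Defs.
From mathcomp Require Import all_boot all_order all_algebra.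
From mathcomp Require Import all_classical all_reals all_analysis.
From mathcomp Require Import fintype finset ring lra zify.
Import Order.TTheory GRing.Theory Num.Theory.
Local Open Scope ring_scope.

(** Suppose [c] has no tight monotone [n]-edge path with at most [s] colors. To
    an increasing [(k-1)]-tuple attach the vector, indexed by the [m] color sets
    [S] of size [s], of the lengths of the longest [S]-colored paths ending
    there. Shifting the tuple by one vertex, along an edge of color [x],
    increases all coordinates [S] containing [x]; since [2s > r] this is a
    strict majority. To a [(k-2)]-tuple [t] attach the set [A t] of the vectors
    of its one-vertex left extensions. If [t'] is a shift of [t], some vector in
    [A t'] beats every vector of [A t] in a majority of coordinates. By the
    minimax theorem for symmetric games there is a random vector of [A t] that no
    vector of [A t] beats, on average, in more than half of the coordinates; so
    the marginals of this random vector, rounded to [O(m)] quantiles each,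
    distinguish [A t] from [A t']. This properly colors the shift graph on
    [(k-2)]-tuples with [n^O(m^2)] colors, and passing from [j]-tuples to
    [(j-1)]-tuples exponentiates the number of colors, until [j = 1]. *)

(** * Approximately optimal strategies in symmetric games *)

Lemma sqr_max0D (F : realFieldType) (a b : F) :
  Num.max 0 (a + b) ^+ 2 <= Num.max 0 a ^+ 2 + 2 * (Num.max 0 a * b) + b ^+ 2.
Proof.
by case: (lerP 0 a) => ha; case: (lerP 0 (a + b)) => hab; nra.
Qed.

Lemma antisymmetric_quadratic_form (F : realFieldType) (T : finType)
    (D : {set T}) (M : T -> T -> F) (y : T -> F) :
  (forall i j, M i j = - M j i) ->
  \sum_(i in D) y i * \sum_(j in D) M i j * y j = 0.
Proof.
move=> Mas; set q := LHS.
suff : q = - q by lra.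
rewrite -sumrN {1}/q.
under eq_bigr do rewrite mulr_sumr.
rewrite exchange_big /=; apply: eq_bigr => j _.
rewrite mulr_sumr -sumrN; apply: eq_bigr => i _.
by rewrite (Mas i j); ring.
Qed.

(* Regret matching: each new strategy is proportional to the positive part of
   the accumulated payoff [x], to which its own payoff is then orthogonal. *)
Lemma regret_matching (F : realFieldType) (T : finType) (D : {set T})
    (M : T -> T -> F) (B : F) (t : nat) :
  D != set0 -> (forall i j, M i j = - M j i) -> (forall i j, `|M i j| <= B) ->
  exists p : T -> F, [/\ forall i, 0 <= p i, \sum_(i in D) p i = t%:R &
    \sum_(i in D) Num.max 0 (\sum_(j in D) M i j * p j) ^+ 2
      <= t%:R * (#|D|%:R * B ^+ 2)].
Proof.
move=> /set0Pn[d dD] Mas MB; elim: t => [|t [p [p0 psum pQ]]].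
  exists (fun=> 0); split => //; first by rewrite big1.
  rewrite mul0r big1 // => i _; rewrite big1 => [|j _]; last by rewrite mulr0.
  by rewrite maxxx expr0n.
pose x i := \sum_(j in D) M i j * p j.
pose y i := Num.max 0 (x i).
have y0 i : 0 <= y i by rewrite /y le_max lexx.
have [q [q0 qsum qy]] : exists q : T -> F, [/\ forall i, 0 <= q i,
    \sum_(i in D) q i = 1 & \sum_(i in D) y i * \sum_(j in D) M i j * q j = 0].
  have P0 : 0 <= \sum_(i in D) y i by exact: sumr_ge0.
  (* If no accumulated payoff is positive, [y] vanishes on [D] and any strategy will do, such as the
     point mass at [d]. *)
  have [Pe|Pn] := eqVneq (\sum_(i in D) y i) 0.
    exists (fun i => (i == d)%:R); split.
    - by move=> i; exact: ler0n.
    - by rewrite (bigD1 d) //= eqxx big1 ?addr0 // => i /andP[_ /negPf ->].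
    - rewrite big1 // => i iD.
      by rewrite (psumr_eq0P (fun i _ => y0 i) Pe iD) mul0r.
  exists (fun i => y i / \sum_(i in D) y i); split.
  - by move=> i; exact: divr_ge0.
  - by rewrite -mulr_suml divff.
  - under eq_bigr do under eq_bigr do rewrite mulrA.
    under eq_bigr do rewrite -mulr_suml mulrA.
    by rewrite -mulr_suml antisymmetric_quadratic_form // mul0r.
exists (fun i => p i + q i); split.
- by move=> i; exact: addr_ge0.
- by rewrite big_split /= psum qsum -natr1.
pose z i := \sum_(j in D) M i j * q j.
have zB i : z i ^+ 2 <= B ^+ 2.
  have zn : `|z i| <= B.
    apply: le_trans (ler_norm_sum _ _ _) _.
    rewrite -[leRHS]mulr1 -qsum mulr_sumr; apply: ler_sum => j _.
    by rewrite normrM (ger0_norm (q0 j)) ler_wpM2r.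
  by rewrite -(real_normK (num_real (z i))) lerXn2r ?nnegrE ?(le_trans _ zn).
have step : \sum_(i in D) Num.max 0 (\sum_(j in D) M i j * (p j + q j)) ^+ 2 <=
   \sum_(i in D) (y i ^+ 2 + 2 * (y i * z i) + z i ^+ 2).
  apply: ler_sum => i _.
  under eq_bigr do rewrite mulrDr.
  by rewrite big_split /= sqr_max0D.
apply: (le_trans step); rewrite !big_split /= -mulr_sumr qy mulr0 addr0.
rewrite -natr1 mulrDl lerD // mul1r mulr_natl -sumr_const.
by apply: ler_sum.
Qed.

(** Average [t] rounds of regret matching: the squared positive payoffs sum to at most linear in
    [t], so each averaged payoff is [O(1 / sqrt t)]. *)
Lemma symmetric_game_strategy (F : archiRealFieldType) (T : finType)
    (D : {set T}) (M : T -> T -> F) (e : F) :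
  D != set0 -> (forall i j, M i j = - M j i) -> 0 < e ->
  exists p : T -> F, [/\ forall i, 0 <= p i, \sum_(i in D) p i = 1 &
    forall i, i \in D -> \sum_(j in D) M i j * p j <= e].
Proof.
move=> D0 Mas e0.
pose B := \sum_i \sum_j `|M i j|.
have MB i j : `|M i j| <= B.
  rewrite /B (bigD1 i) //= (bigD1 j) //= -addrA lerDl.
  by rewrite addr_ge0 ?sumr_ge0 // => k _; exact: sumr_ge0.
pose t := (Num.bound (#|D|%:R * B ^+ 2 / e ^+ 2)).+1.
have t0 : 0 < t%:R :> F by rewrite ltr0n.
have tB : #|D|%:R * B ^+ 2 <= t%:R * e ^+ 2.
  rewrite -ler_pdivrMr ?exprn_gt0 //; apply: ltW.
  have q0 : 0 <= #|D|%:R * B ^+ 2 / e ^+ 2.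
    exact: divr_ge0 (mulr_ge0 (ler0n _ _) (sqr_ge0 _)) (sqr_ge0 _).
  by apply: lt_le_trans (archi_boundP q0) _; rewrite ler_nat.
have [p [p0 psum pQ]] := regret_matching _ _ _ _ _ t D0 Mas MB.
exists (fun i => p i / t%:R); split.
- by move=> i; apply: divr_ge0 => //; exact: ltW.
- by rewrite -mulr_suml psum divff ?gt_eqF.
move=> i iD.
under eq_bigr do rewrite mulrA.
rewrite -mulr_suml ler_pdivrMr //.
set x := \sum_(j in D) _.
have : Num.max 0 x ^+ 2 <= (e * t%:R) ^+ 2.
  apply: (@le_trans _ _ (t%:R * (#|D|%:R * B ^+ 2))).
    apply: le_trans pQ; rewrite (bigD1 i) //= lerDl.
    by apply: sumr_ge0 => j _; exact: sqr_ge0.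
  have -> : (e * t%:R) ^+ 2 = t%:R * (t%:R * e ^+ 2) by ring.
  by rewrite ler_pM2l.
have et0 : 0 <= e * t%:R by rewrite mulr_ge0 ?ler0n // ltW.
by rewrite ler_pXn2r ?nnegrE ?le_max ?lexx // ge_max => /andP[].
Qed.

(** * Rounded marginals and majority separation *)

Lemma downset_eq_card (n : nat) (A B : {set 'I_n}) :
  (forall u v : 'I_n, (u <= v)%N -> v \in A -> u \in A) ->
  (forall u v : 'I_n, (u <= v)%N -> v \in B -> u \in B) ->
  #|A| = #|B| -> A = B.
Proof.
move=> dA dB cAB; have [AB|/subsetPn[a aA aB]] := boolP (A \subset B).
  by apply/eqP; rewrite eqEcard AB cAB /=.
apply/esym/eqP; rewrite eqEcard cAB leqnn andbT; apply/subsetP => b bB.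
apply: dA aA; rewrite leqNgt; apply: contra aB => ab.
exact: dB (ltnW ab) bB.
Qed.

(** The sublevel sets are initial segments, so their cardinalities determine them. With [j] the
    integer part of [K%:R * g v], [v] lies outside the sublevel set of [g], hence outside that of
    [h]. *)
Lemma quantiles_determine_monotone (F : archiRealFieldType) (n K : nat)
    (g h : 'I_n -> F) :
  {homo g : u v / (u <= v)%N >-> u <= v} ->
  {homo h : u v / (u <= v)%N >-> u <= v} ->
  (forall v, 0 <= g v <= 1) ->
  (forall j : 'I_K.+1, #|[set v | K%:R * g v < j%:R]| =
                       #|[set v | K%:R * h v < j%:R]|) ->
  forall v, K%:R * g v < K%:R * h v + 1.
Proof.
move=> gm hm g01 qE v; have /andP[gv0 gv1] := g01 v.
have Kg0 : 0 <= K%:R * g v by rewrite mulr_ge0 ?ler0n.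
have /andP[lo hi] := truncn_itv Kg0.
set j := Num.truncn _ in lo hi.
have jK : (j < K.+1)%N.
  rewrite ltnS -(ler_nat F); apply: le_trans lo _.
  by rewrite ler_piMr ?ler0n.
have mono (f : 'I_n -> F) : {homo f : u v / (u <= v)%N >-> u <= v} ->
    forall u w : 'I_n, (u <= w)%N -> w \in [set v | K%:R * f v < j%:R] ->
      u \in [set v | K%:R * f v < j%:R].
  move=> fm u w uw; rewrite !inE; apply: le_lt_trans.
  by rewrite ler_wpM2l ?ler0n ?fm.
have /setP/(_ v) := downset_eq_card _ _ _ (mono _ gm) (mono _ hm)
  (qE (Ordinal jK)).
rewrite !inE ltNge lo => /esym/negbT; rewrite -leNgt => hj.
by apply: lt_le_trans hi _; rewrite -natr1 lerD2r.
Qed.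

(* A finite set [A] of vectors is summarised by the marginals of an optimal
   mixed strategy [p] on [A] in the symmetric game whose payoff is the number of
   coordinates won minus the number of coordinates lost. *)
Lemma majority_marginals (F : archiRealFieldType) (I : finType) (n : nat)
    (A : {set {ffun I -> 'I_n}}) :
  A != set0 ->
  exists g : I -> 'I_n -> F, [/\
    forall i, {homo g i : u v / (u <= v)%N >-> u <= v},
    forall i v, 0 <= g i v <= 1,
    forall a, a \in A -> \sum_i g i (a i) <= #|I|%:R / 2 + 4^-1 &
    forall b : {ffun I -> 'I_n},
      (forall a : {ffun I -> 'I_n}, a \in A ->
         (#|I| < 2 * #|[set i | (a i < b i)%N]|)%N) ->
      (#|I|%:R + 1) / 2 <= \sum_i g i (b i)].
Proof.
move=> A0.
pose w (b a : {ffun I -> 'I_n}) : F := #|[set i | (a i < b i)%N]|%:R.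
pose M b a : F := w b a - w a b.
have Mas b a : M b a = - M a b by rewrite /M opprB.
(* Accuracy 1/2 bounds the mean number of wins by [#|I|%:R / 2 + 1/4], still 1/4 below what a strict
   majority gives. *)
have h0 : 0 < 2^-1 :> F by rewrite invr_gt0 ltr0n.
have [p [p0 p1 pM]] := symmetric_game_strategy _ _ _ _ _ A0 Mas h0.
(* The distribution function of coordinate [i] of a [p]-random vector of [A]. *)
pose g i (v : 'I_n) := \sum_(a in A | (a i < v)%N) p a.
have gE (b : {ffun I -> 'I_n}) : \sum_i g i (b i) = \sum_(a in A) w b a * p a.
  rewrite /g; under eq_bigr do rewrite big_mkcondr.
  rewrite exchange_big /=; apply: eq_bigr => a _.
  rewrite -big_mkcond /= sumr_const /w mulr_natl; congr (_ *+ _).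
  by apply: eq_card => i; rewrite !inE.
exists g; split.
- move=> i u v uv; rewrite /g !big_mkcondr; apply: ler_sum => a _.
  by case: ltnP => [/leq_trans/(_ uv) -> //|_]; case: ifP.
- move=> i v; rewrite sumr_ge0 //= -p1 /g big_mkcondr; apply: ler_sum => a _.
  by case: ifP.
- move=> b bA; rewrite gE.
  have ww a : w b a + w a b <= #|I|%:R.
    rewrite /w -natrD ler_nat -cardsUI.
    have -> : [set i | (a i < b i)%N] :&: [set i | (b i < a i)%N] = set0.
      by apply/setP => i; rewrite !inE; case: ltngtP.
    by rewrite cards0 addn0 max_card.
  have : \sum_(a in A) (w b a + w a b) * p a <= #|I|%:R.
    rewrite -[leRHS]mulr1 -[X in _ <= _ * X]p1 mulr_sumr; apply: ler_sum => a _.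
    by rewrite ler_wpM2r.
  have := pM b bA; rewrite /M.
  under eq_bigr do rewrite mulrBl.
  rewrite sumrB => h1.
  under eq_bigr do rewrite mulrDl.
  rewrite big_split /= => h2.
  lra.
- move=> b bA; rewrite gE -[leLHS]mulr1 -[X in _ * X <= _]p1 mulr_sumr.
  apply: ler_sum => a aA.
  rewrite ler_wpM2r // ler_pdivrMr ?ltr0n // natr1 /w -natrM ler_nat mulnC.
  exact: bA.
Qed.

(** The scores of [b] against the two strategies differ by at least 1/4. If the rounded marginals
    agreed, each coordinate would contribute less than [1 / K], in total less than [#|I| / K = 1/4].
    The value [None] is reserved for the empty set. *)
Lemma majority_separation (I : finType) (n : nat) :
  exists sigma : {set {ffun I -> 'I_n}} ->
      option {ffun I * 'I_(4 * #|I|).+1 -> 'I_n.+1},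
    forall (A B : {set {ffun I -> 'I_n}}) (b : {ffun I -> 'I_n}), b \in B ->
      (forall a : {ffun I -> 'I_n}, a \in A ->
         (#|I| < 2 * #|[set i | (a i < b i)%N]|)%N) ->
      sigma A <> sigma B.
Proof.
have /boolp.choice[G GP] : forall A : {set {ffun I -> 'I_n}},
    exists g : I -> 'I_n -> rat, A != set0 -> [/\
    forall i, {homo g i : u v / (u <= v)%N >-> u <= v},
    forall i v, 0 <= g i v <= 1,
    forall a, a \in A -> \sum_i g i (a i) <= #|I|%:R / 2 + 4^-1 &
    forall b : {ffun I -> 'I_n},
      (forall a : {ffun I -> 'I_n}, a \in A ->
         (#|I| < 2 * #|[set i | (a i < b i)%N]|)%N) ->
      (#|I|%:R + 1) / 2 <= \sum_i g i (b i)].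
  move=> A; have [->|A0] := eqVneq A set0; first by exists (fun _ _ => 0).
  by have [g gP] := majority_marginals rat I n A A0; exists g.
pose K := (4 * #|I|)%N.
exists (fun A => if A == set0 then None else
  Some [ffun ij : I * 'I_K.+1 =>
    inord #|[set v | K%:R * G A ij.1 v < ij.2%:R]|]).
move=> A B b bB Ab.
have B0 : B != set0 by apply/set0Pn; exists b.
rewrite (negPf B0); have [//|A0] := eqVneq; case => /ffunP sE.
have [gA m01A _ /(_ b Ab) lb] := GP A A0.
have [gB _ /(_ b bB) ub _] := GP B B0.
have I0 : (0 < #|I|)%N.
  rewrite lt0n; apply/eqP => I0; case/set0Pn: A0 => a /Ab.
  by rewrite I0 muln_gt0 /= => /card_gt0P[i _]; have := fintype0 i I0.
have : \sum_i K%:R * G A i (b i) < \sum_i (K%:R * G B i (b i) + 1).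
  apply: ltr_sum => [|i _].
    by case/card_gt0P: I0 => i _; apply/hasP; exists i; rewrite ?mem_index_enum.
  apply: quantiles_determine_monotone => // j.
  have := sE (i, j); rewrite !ffunE /= => /(congr1 (@nat_of_ord _)).
  by rewrite !inordK // ltnS -[leqRHS]card_ord max_card.
rewrite big_split /= -!mulr_sumr sumr_const /K.
rewrite natrM.
have : 0 < #|I|%:R :> rat by rewrite ltr0n.
move: (#|I|%:R) lb ub => m; nra.
Qed.

(** * Colorings of shift graphs *)

Definition increasing (N : nat) (t : seq 'I_N) : bool :=
  sorted (fun i j : 'I_N => (i < j)%N) t.

Lemma increasing_rcons (N : nat) (x : 'I_N) (t : seq 'I_N) (y : 'I_N) :
  t != [::] -> increasing N (x :: t) -> increasing N (rcons t y) ->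
  increasing N (x :: rcons t y).
Proof. by case: t => //= z t _ /andP[xz _] zt; rewrite /increasing /= xz. Qed.

(* [F] is a proper coloring, at increasing sequences of length [p.+1], of the
   shift graph. *)
Definition shift_coloring (N p : nat) (X : Type) (F : seq 'I_N -> X) : Prop :=
  forall x t y, size t = p -> increasing N (x :: rcons t y) ->
    F (x :: t) <> F (rcons t y).

(** Recolor a shorter sequence by the set of colors of its left extensions. Were [w :: t] and
    [rcons t y] to get equal sets, the color of [w :: rcons t y] would recur at some [x :: w :: t],
    which precedes it in the shift graph. *)
Lemma shift_coloring_bound (N p : nat) (X : finType) (F : seq 'I_N -> X) :
  shift_coloring N p X F -> (N <= iter p (expn 2) #|X|)%N.
Proof.
elim: p X F => [|p IHp] X F Fp.
  rewrite -[leqLHS]card_ord; apply: (leq_card (fun x => F [:: x])) => x y Fxy.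
  have [xy|yx|/val_inj //] := ltngtP x y.
  - by case: (Fp x [::] y); rewrite // /increasing /= xy.
  - by case: (Fp y [::] x); rewrite // /increasing /= yx.
have cX : (2 ^ #|X|)%N = #|{set X}|.
  by rewrite -cardsT -card_powerset powersetT cardsT.
rewrite iterSr cX.
apply: (IHp _ (fun t => [set F (x :: t) | x : 'I_N & increasing N (x :: t)])).
move=> w t y tp inc GE.
have : F (w :: rcons t y) \in
    [set F (x :: rcons t y) | x : 'I_N & increasing N (x :: rcons t y)].
  by apply/imsetP; exists w; rewrite ?inE.
rewrite -GE => /imsetP[x]; rewrite inE => xinc FE.
apply: (Fp x (w :: t) y); rewrite ?FE //= ?tp //.
by apply: (increasing_rcons N x (w :: t) y).
Qed.

(** * Colored paths as sequences of vertices *)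

(** When [u] has [k - 1] entries, prepending [l] vertices creates exactly [l] edges, the windows of
    length [k]. *)
Definition colored_path_to (N r k : nat) (c : {set 'I_N} -> 'I_r)
    (S : {set 'I_r}) (l : nat) (u : seq 'I_N) : Prop :=
  exists q : seq 'I_N, [/\ size q = l, increasing N (q ++ u) &
    forall i, (i < l)%N -> c [set z in take k (drop i (q ++ u))] \in S].

Lemma colored_path_to_extend (N r k : nat) (c : {set 'I_N} -> 'I_r)
    (S : {set 'I_r}) (l : nat) (x : 'I_N) (t : seq 'I_N) (y : 'I_N) :
  (size t).+2 = k -> increasing N (x :: rcons t y) ->
  c [set z in x :: rcons t y] \in S ->
  colored_path_to N r k c S l (x :: t) ->
  colored_path_to N r k c S l.+1 (rcons t y).
Proof.
move=> tk inc cS [q [ql qinc qS]].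
exists (rcons q x); rewrite size_rcons ql cat_rcons; split => //.
- move: inc qinc; rewrite /increasing !sorted_cat_cons => inc /andP[-> _].
  exact: inc.
(* Window [l] is the new edge; the earlier windows end before [y]. *)
- move=> i; rewrite ltnS leq_eqVlt => /orP[/eqP ->|il].
    by rewrite drop_size_cat // take_oversize //= size_rcons tk.
  have -> : q ++ x :: rcons t y = (q ++ x :: t) ++ [:: y].
    by rewrite -catA /= cats1.
  rewrite drop_cat size_cat ifT; last by rewrite ql ltn_addr.
  rewrite takel_cat; first exact: qS.
  by rewrite size_drop size_cat /= ql; lia.
Qed.

Lemma colored_path_to_path (N r k n : nat) (c : {set 'I_N} -> 'I_r)
    (S : {set 'I_r}) (u : seq 'I_N) :
  (0 < k)%N -> (size u).+1 = k -> (0 < n)%N -> colored_path_to N r k c S n u ->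
  exists2 v : 'I_(n + k).-1 -> 'I_N, monotone_vertices v &
    [set c (path_edge (k := k) v i) | i : 'I_n] \subset S.
Proof.
move=> k0 uk n0 [q [qn inc qS]].
have szw : size (q ++ u) = (n + k).-1 by rewrite size_cat qn -uk addnS.
have [x0 _] : exists x : 'I_N, True.
  by move: qn n0; case: (q) => [<- //|x q' _ _]; exists x.
exists (fun j => nth x0 (q ++ u) j).
  move=> i j ij; move: inc; rewrite /increasing => inc.
  have tr : transitive (fun i j : 'I_N => (i < j)%N).
    by move=> a b d; exact: ltn_trans.
  by apply: (sorted_ltn_nth tr x0 inc); rewrite ?inE ?szw.
apply/subsetP => _ /imsetP[i _ ->].
suff -> : path_edge (k := k) (fun j => nth x0 (q ++ u) j) i =
    [set z in take k (drop i (q ++ u))] by exact: qS.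
have ik : (i + k <= size (q ++ u))%N by rewrite szw; have := ltn_ord i; lia.
have szt : size (take k (drop i (q ++ u))) = k.
  by rewrite size_takel // size_drop; lia.
apply/setP => z; rewrite inE; apply/imsetP/(nthP x0).
- case=> j; rewrite inE => /andP[ij jk] ->; exists (j - i)%N.
    by rewrite szt; lia.
  by rewrite nth_take ?nth_drop ?subnKC //; lia.
- rewrite szt => -[j jk <-].
  have ji : (i + j < (n + k).-1)%N by rewrite -szw; lia.
  exists (Ordinal ji); first by rewrite inE /=; lia.
  by rewrite nth_take // nth_drop.
Qed.

(** * From path lengths to a shift coloring *)

Lemma card_fixed_size_sets (r s : nat) :
  #|{: {S : {set 'I_r} | #|S| == s}}| = 'C(r, s).
Proof.
rewrite card_sig -[X in 'C(X, s)]card_ord -card_draws.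
by apply: eq_card => S; rewrite !inE.
Qed.

(** The sets avoiding [x] form the fraction [(r - s) / r] of all, below 1/2 because [r < 2 * s]. *)
Lemma majority_contains (r s : nat) (x : 'I_r) :
  (s < r)%N -> (r < 2 * s)%N ->
  ('C(r, s) <
    2 * #|[set S : {S : {set 'I_r} | #|S| == s} | x \in val S]|)%N.
Proof.
move=> sr rs; set D := [set S | _].
have cDC : (#|~: D| <= 'C(r.-1, s))%N.
  have -> : r.-1 = #|~: [set x]| by rewrite cardsC1 card_ord.
  rewrite -cards_draws -(card_imset _ val_inj); apply: subset_leq_card.
  apply/subsetP => _ /imsetP[S SD ->]; rewrite !inE (valP S) andbT.
  move: SD; rewrite !inE => xS; apply/subsetP => z zS; rewrite !inE.
  by apply: contraNneq xS => <-.
have := cardsC D; rewrite card_fixed_size_sets => cD.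
have bin := mul_bin_down r s.
have b0 : (0 < 'C(r, s))%N by rewrite bin_gt0 ltnW.
suff : (2 * 'C(r.-1, s) < 'C(r, s))%N by lia.
have r0 : (0 < r)%N by exact: leq_ltn_trans sr.
rewrite -(ltn_pmul2l r0) mulnCA bin mulnA ltn_pmul2r //; lia.
Qed.

Lemma forces_path_large (k n r s N : nat) :
  (3 <= k)%N -> (0 < n)%N -> (s < r)%N -> (r < 2 * s)%N ->
  (iter (k - 3) (expn 2)
     (n.+1 ^ ('C(r, s) * (4 * 'C(r, s)).+1)).+1 < N)%N ->
  forces_path k n r s N.
Proof.
move=> k3 n0 sr rs; apply: contraTP => nf; rewrite -leqNgt.
have [c cP] : exists c : {set 'I_N} -> 'I_r,
    forall v : 'I_(n + k).-1 -> 'I_N, monotone_vertices v ->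
      (s < #|[set c (path_edge (k := k) v i) | i : 'I_n]|)%N.
  move/existsNP: nf => [c cP]; exists c => v vm; rewrite ltnNge.
  by apply/negP => vs; apply: cP; exists v.
pose I := {S : {set 'I_r} | #|S| == s}.
have nopath (S : I) u : (size u).+1 = k ->
    ~ colored_path_to N r k c (val S) n u.
  move=> uk /(colored_path_to_path _ _ _ _ _ _ _ (ltnW (ltnW k3)) uk n0).
  case=> v /cP; rewrite ltnNge => /negP nv /subset_leq_card; apply: contra_not nv.
  by rewrite (eqP (valP S)).
case: n n0 {nf} cP nopath => // n _ cP nopath.
(* The number of edges is now [n.+1], so every attained length fits in ['I_n.+1]. For increasing [u]
   the value [ord0] is attained by the empty prefix. *)
pose f (u : seq 'I_N) : {ffun I -> 'I_n.+1} := [ffun S : I =>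
  [arg max_(l > ord0 | `[<colored_path_to N r k c (val S) l u>]) (l : nat)]%N].
have finc x t y (S : I) : (size t).+2 = k -> increasing N (x :: rcons t y) ->
    c [set z in x :: rcons t y] \in val S ->
    (f (x :: t) S < f (rcons t y) S)%N.
  move=> tk inc cS; rewrite !ffunE.
  have path0 u : increasing N u -> `[<colored_path_to N r k c (val S) 0 u>].
    by move=> uinc; apply/asboolP; exists [::].
  case: arg_maxnP => [|l /asboolP lP _].
    apply: path0; move: inc; rewrite /increasing -cats1 -cat_cons.
    by move=> /cat_sorted2[].
  case: arg_maxnP => [|l' _ l'max].
    by apply: path0; move: inc; rewrite /increasing => /path_sorted.
  have lP' := colored_path_to_extend _ _ _ _ _ _ _ _ _ tk inc cS lP.
  have ln : (l.+1 < n.+1)%N.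
    rewrite ltn_neqAle ltn_ord andbT; apply/eqP => ln.
    by apply: (nopath S (rcons t y)); rewrite ?size_rcons // -ln.
  by apply: (l'max (Ordinal ln)); apply/asboolP.
have [sigma sigmaP] := majority_separation I n.+1.
pose F t := sigma [set f (x :: t) | x : 'I_N & increasing N (x :: t)].
have Fp : shift_coloring N (k - 3) _ F.
  move=> x t y tk inc.
  (* The edge [w :: x :: rcons t y] shows that the vector of [x :: rcons t y] beats that of
     [w :: x :: t] at each [S] containing its color. *)
  apply: (sigmaP _ _ (f (x :: rcons t y))).
    by apply/imsetP; exists x; rewrite ?inE.
  move=> a /imsetP[w]; rewrite inE => winc -> {a}.
  have wxinc := increasing_rcons _ _ (x :: t) y isT winc inc.
  rewrite card_fixed_size_sets.
  have maj := majority_contains r s (c [set z in w :: x :: rcons t y]) sr rs.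
  apply: leq_trans maj _.
  rewrite leq_mul2l /=; apply/subset_leq_card/subsetP => S; rewrite !inE => cS.
  by apply: (finc w (x :: t) y S) => //=; rewrite tk; lia.
have := shift_coloring_bound _ _ _ _ Fp.
by rewrite card_option card_ffun card_prod !card_ord card_fixed_size_sets.
Qed.

(** * Tower estimates and the final bound *)

Lemma tower_natr (R : realType) (j m : nat) :
  tower j (m%:R : R) = (iter j (expn 2) m)%:R.
Proof.
elim: j => //= j ->.
by rewrite powR_mulrn ?ler0n // -natrX.
Qed.

Lemma ler_tower (R : realType) (j : nat) (x y : R) :
  x <= y -> tower j x <= tower j y.
Proof.
by move=> xy; elim: j => //= j IHj; apply: ler_powR IHj; rewrite ler1n.
Qed.

Lemma ltn_iter_expn2 (j a b : nat) :
  (a < b)%N -> (iter j (expn 2) a < iter j (expn 2) b)%N.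
Proof. by move=> ab; elim: j => //= j IHj; rewrite ltn_exp2l. Qed.

Lemma bin_gt1 (r s : nat) : (0 < s)%N -> (s < r)%N -> (1 < 'C(r, s))%N.
Proof.
case: r s => // r [//|s] _ sr; rewrite binS.
have s1 : (0 < 'C(r, s.+1))%N by rewrite bin_gt0.
have s0 : (0 < 'C(r, s))%N by rewrite bin_gt0; exact: ltnW.
by lia.
Qed.

(** Use [n.+1 <= n ^ 2]; one further factor [n >= 3] absorbs the added 2, and
    [2 * e + 1 = 8 m^2 + 2 m + 1 <= 12 m^2]. *)
Lemma color_count_bound (n m : nat) : (3 <= n)%N -> (0 < m)%N ->
  ((n.+1 ^ (m * (4 * m).+1)).+2 <= n ^ (12 * m ^ 2))%N.
Proof.
move=> n3 m0; set e := (m * _)%N.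
have n0 : (0 < n)%N by exact: leq_trans n3.
have ne : (n.+1 ^ e <= n ^ (2 * e))%N.
  by rewrite expnM leq_exp2r ?muln_gt0 ?m0 //; nia.
have ne1 : (n ^ (2 * e).+1 <= n ^ (12 * m ^ 2))%N.
  by rewrite leq_pexp2l // /e expnS expn1; nia.
apply: leq_trans ne1; rewrite expnS.
have : (0 < n ^ (2 * e))%N by rewrite expn_gt0 n0.
by nia.
Qed.

Theorem theorem1p6 (R : realType) :
  exists2 C : R, 0 < C &
    forall n k r s : nat,
      (3 <= k)%N -> (k <= n)%N -> (0 < s)%N -> (s < r)%N -> (r < 2 * s)%N ->
      exists2 N : nat, is_A k n r s N &
        N%:R <= tower (k - 3)
          (n%:R `^ (C * 'C(r, s)%:R ^+ 2 * ln 'C(r, s)%:R)).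
Proof.
have ln2 : 0 < ln 2 :> R by rewrite ln_gt0 // ltr1n.
(* Since the binomial coefficient is at least 2, its logarithm divided by [ln 2] is at least 1, so
   the exponent is at least [12 * m ^ 2]. *)
exists (12 / ln 2); first by rewrite divr_gt0 ?ltr0n.
move=> n k r s k3 kn s0 sr rs.
have n3 := leq_trans k3 kn.
have m2 := bin_gt1 r s s0 sr.
set m := 'C(r, s) in m2 *.
pose Q := (n.+1 ^ (m * (4 * m).+1)).+1.
have large := forces_path_large k n r s _ k3 (ltnW (ltnW n3)) sr rs (ltnSn _).
have exN : exists N, `[<forces_path k n r s N>] 
  by exists (iter (k - 3) (expn 2) Q).+1; apply/asboolP.
case: (ex_minnP exN) => N /asboolP NP Nmin.
exists N; first by split=> // M MP; apply: Nmin; apply/asboolP.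
(* Strict monotonicity of the iterated exponential moves the outer successor inside. *)
have NQ : (N <= iter (k - 3) (expn 2) Q.+1)%N.
  apply: leq_trans (ltn_iter_expn2 _ _ _ (ltnSn Q)).
  by apply: Nmin; apply/asboolP.
apply: (@le_trans _ _ (iter (k - 3) (expn 2) Q.+1)%:R); first by rewrite ler_nat.
rewrite -tower_natr; apply: ler_tower.
apply: (@le_trans _ _ (n ^ (12 * m ^ 2))%:R).
  by rewrite ler_nat color_count_bound // ltnW.
rewrite natrX -[leLHS]powR_mulrn ?ler0n //; apply: ler_powR.
  by rewrite ler1n (leq_trans _ n3).
rewrite natrM natrX [leRHS]mulrAC ler_wpM2r ?exprn_ge0 ?ler0n //.
rewrite mulrAC -mulrA ler_peMr ?ler0n // ler_pdivlMr // mul1r.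
by rewrite ler_ln ?posrE ?ltr0n ?ler_nat // ltnW.
Qed.
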